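(* Let $q$ be an indeterminate. For integers $k,m\ge 0$ let $a_{k,m}=h_{2m-k}(\{1,q\}^{k-m+1})$, i.e. $a_{k,m}=\sum_{i=0}^{2m-k}\binom{k-m+i}{k-m}\binom{m-i}{k-m}q^i$ for $m\le k$ and $a_{k,m}=0$ for $m>k$. Then for every integer $n\ge 0$ the inverse of the lower triangular matrix $\left(a_{k,m}\right)_{k,m\in\{0,\dots,n\}}$ is the lower triangular matrix $$\left((-1)^{k-m}\frac{[m]!}{[k+1]!}P_{k,k-m}\right)_{k,m\in\{0,\dots,n\}},$$ where the entries with $m>k$ are $0$.
   Context: $[k]=\frac{1-q^k}{1-q}$ and $[k]!=\prod_{i=1}^k [i]$ (so $[0]!=1$). For integers $j$ and $r\ge 1$, $h_j(\{1,q\}^r)$ denotes the complete homogeneous symmetric polynomial of degree $j$ in $2r$ variables, $r$ of which are specialised to $q$ and $r$ to $1$; it is $0$ when $j<0$. For $m,n\in\mathbb{N}$ let $S_{m,n}(q)=\sum_{k=1}^{n}\frac{[2k]}{[2]}[k]^{m-1}q^{\frac{m+1}{2}(n-k)}$. The polynomials $P_{m,k}\in\mathbb{Z}[q]$ ($0\le k\le m$) are the $q$-Faulhaber polynomials of Guo and Zeng, i.e. the polynomials for which, for all $m\ge 0$ and all $n\ge 1$, $$S_{2m+1,n}(q)=\sum_{k=0}^m(-1)^{m-k}\frac{[k]!}{[m+1]!}P_{m,m-k}\,q^{(m-k)n}\frac{([n][n+1])^{k+1}}{[2]}.$$ *)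

(* Defs.v *)
From HB Require Import structures.
From mathcomp Require Import all_boot all_order all_algebra.
From mathcomp Require Import fraction mpoly.

Set Implicit Arguments.
Unset Strict Implicit.
Unset Printing Implicit Defensive.

Import GRing.Theory.
Local Open Scope ring_scope.

(* The field of rational functions in q, with Z[q] realised as {poly int}
   and embedded by tofrac. *)
Notation Kq := {fraction {poly int}}.

Definition q : Kq := tofrac 'X.

Definition qint (k : nat) : Kq := (1 - q ^+ k) / (1 - q).

Definition qfact (k : nat) : Kq := \prod_(1 <= i < k.+1) qint i.

(* The sum of all monomials of total degree d in N variables. *)
Definition complete_sym (R : nzRingType) (N d : nat) : {mpoly R[N]} :=
  \sum_(mu : 'X_{1..N < d.+1} | mdeg mu == d) 'X_[mu].

(* h_j({1,q}^r) *)
Definition h1q (j : int) (r : nat) : Kq :=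
  match j with
  | Posz d =>
      (complete_sym Kq (r + r) d).@[fun i : 'I_(r + r) => if (i < r)%N then q else 1]
  | Negz _ => 0
  end.

(* For m <= k the truncated subtraction (k - m).+1 is the integer k - m + 1. *)
Definition acoef (k m : nat) : Kq :=
  if (m <= k)%N then h1q ((2 * m)%N%:Z - k%:Z) (k - m).+1 else 0.

(* S_{2m+1,n}(q): for the odd first index 2m+1 the exponent (m'+1)/2 of the
   general summand [2k]/[2] [k]^(m'-1) q^((m'+1)/2 (n-k)) is the integer m+1. *)
Definition qsum_odd (m n : nat) : Kq :=
  \sum_(1 <= k < n.+1)
     qint (2 * k) / qint 2 * qint k ^+ (2 * m) * q ^+ (m.+1 * (n - k)).

(* The values P m k with k > m are irrelevant and left unconstrained. *)
Definition q_Faulhaber (P : nat -> nat -> {poly int}) : Prop :=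
  forall m n : nat, (1 <= n)%N ->
    qsum_odd m n =
    \sum_(0 <= k < m.+1)
       (-1) ^+ (m - k) * (qfact k / qfact m.+1) * tofrac (P m (m - k)%N) *
       q ^+ ((m - k) * n) * ((qint n * qint n.+1) ^+ k.+1 / qint 2).

(* Main.v *)
(** Put [z_n = [n]^2 / q^n] and [y_n = [n][n+1] / q^n].  Dividing the Faulhaber
identity by [q^((m+1)n)] turns its right-hand side into a polynomial in [y_n], and
taking differences in [n] turns its left-hand side into a multiple of [z_n^m]: with
[B] the matrix of Faulhaber coefficients,
[sum_k B_(m,k) h_k(y_n, y_(n-1)) = z_n^m].  Since [y_n + y_(n-1) = (1 + q) z_n] and
[y_n y_(n-1) = q z_n^2 - z_n], the generating function of the [h_k(y_n, y_(n-1))] is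
[1 / ((1 - z t)(1 - q z t) - z t^2) = sum_r z^r t^(2r) / ((1 - z t)(1 - q z t))^(r+1)]
with [z = z_n], that is [h_k(y_n, y_(n-1)) = sum_m a_(k,m) z_n^m].  As the [z_n] are
pairwise distinct, comparing polynomials in [z] gives [B A = 1]. *)

Require Import Defs.
From HB Require Import structures.
From mathcomp Require Import all_boot all_order all_algebra.
From mathcomp Require Import fraction mpoly ring zify.

Set Implicit Arguments.
Unset Strict Implicit.
Unset Printing Implicit Defensive.

Import GRing.Theory.
Local Open Scope ring_scope.

(** * Complete symmetric polynomials at two blocks of equal variables *)

Section CompleteSymmetric.
Variable R : comNzRingType.
Implicit Types (x y : R) (N r s d j k : nat).

(** Coefficient extraction from $\prod_i 1/(1 - v_i t)$. Cutting each series after $t^d$ is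
    harmless: no exponent in a monomial of degree $d$ exceeds $d$. *)
Lemma meval_complete_sym N d (v : 'I_N -> R) :
  (complete_sym R N d).@[v] = (\prod_i \poly_(e < d.+1) v i ^+ e)`_d.
Proof.
rewrite /complete_sym (raddf_sum (meval v)) /=.
under eq_bigr do rewrite mevalX.
under [in RHS]eq_bigr do rewrite poly_def.
rewrite bigA_distr_bigA coef_sum /=.
under [RHS]eq_bigr => f _ do rewrite scaler_prod -expr_sum coefZ coefXn mulr_natr mulrb.
rewrite -big_mkcond /=.
pose ffun_of (mu : 'X_{1..N < d.+1}) : {ffun 'I_N -> 'I_d.+1} :=
  [ffun i => inord (mu i)].
pose mnm_of (f : {ffun 'I_N -> 'I_d.+1}) : 'X_{1..N < d.+1} :=
  insubd bm0 [multinom nat_of_ord (f i) | i < N].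
have ffun_ofE mu i : ffun_of mu i = mu i :> nat.
  rewrite ffunE inordK //; apply: leq_ltn_trans (bmdeg mu).
  by rewrite mdegE (bigD1 i) //= leq_addr.
rewrite (reindex_onto ffun_of mnm_of) => [|f /eqP df]; last first.
  apply/ffunP=> i; apply: ord_inj; rewrite ffun_ofE /mnm_of insubdK ?mnmE //.
  by rewrite unfold_in /= mdegE; under eq_bigr do rewrite mnmE; rewrite -df.
apply: eq_big => [mu | mu _]; last by apply: eq_bigr => i _; rewrite ffun_ofE.
have -> : mnm_of (ffun_of mu) == mu.
  have mnmK : [multinom nat_of_ord (ffun_of mu i) | i < N] = mu.
    by apply/mnmP=> i; rewrite mnmE ffun_ofE.
  by apply/eqP/val_inj; rewrite /mnm_of insubdK mnmK // unfold_in /= bmdeg.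
by rewrite andbT mdegE eq_sym; under [in RHS]eq_bigr do rewrite ffun_ofE.
Qed.

Lemma sum_bin_diag r j : (\sum_(i < j.+1) 'C(r + i, r) = 'C(r.+1 + j, r.+1))%N.
Proof.
elim: j => [|j IHj]; first by rewrite big_ord1 !addn0 !binn.
by rewrite big_ord_recr /= IHj [in RHS]addnS binS -addSnnS.
Qed.

Lemma coef_geomX x d r j : (j <= d)%N ->
  ((\poly_(e < d.+1) x ^+ e) ^+ r.+1)`_j = 'C(r + j, r)%:R * x ^+ j.
Proof.
elim: r j => [|r IHr] j le_jd; first by rewrite expr1 coef_poly ltnS le_jd bin0 mul1r.
rewrite exprS coefMr -sum_bin_diag natr_sum mulr_suml; apply: eq_bigr => i _.
have le_ij : (i <= j)%N by rewrite -ltnS ltn_ord.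
rewrite IHr ?(leq_trans le_ij) // coef_poly ltnS (leq_trans (leq_subr _ _)) //.
by rewrite mulrCA -exprD subnK.
Qed.

(** The coefficient of $t^j$ in $1/((1 - xt)^{r+1}(1 - t)^{s+1})$. Independent [r] and [s] allow one
    factor to be removed at a time. *)
Definition bin_conv x r s j : R :=
  \sum_(i < j.+1) 'C(r + i, r)%:R * 'C(s + (j - i), s)%:R * x ^+ i.

Lemma complete_sym_two_blocks x r d :
  (complete_sym R (r.+1 + r.+1) d).@[fun i => if (i < r.+1)%N then x else 1]
  = bin_conv x r r d.
Proof.
rewrite meval_complete_sym big_split_ord /=.
rewrite (eq_bigr (fun=> \poly_(e < d.+1) x ^+ e)) => [|i _]; last first.
  by rewrite /= ltn_ord.
rewrite [X in _ * X](eq_bigr (fun=> \poly_(e < d.+1) 1 ^+ e)) => [|i _]; last first.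
  by rewrite /= ltnNge leq_addr.
rewrite !prodr_const card_ord coefM; apply: eq_bigr => i _.
rewrite !coef_geomX ?leq_subr //; last by rewrite -ltnS ltn_ord.
by rewrite expr1n mulr1 mulrAC.
Qed.

Lemma bin_convSl x r s j :
  bin_conv x r.+1 s j.+1 = x * bin_conv x r.+1 s j + bin_conv x r s j.+1.
Proof.
rewrite /bin_conv !(big_ord_recl j.+1) /= !addn0 !binn addrCA.
congr (_ + _); rewrite mulr_sumr -big_split; apply: eq_bigr => i _.
rewrite /bump /= !add1n subSS !addnS !addSn binS natrD exprS; ring.
Qed.

Lemma bin_convSr x r s j :
  bin_conv x r s.+1 j.+1 = bin_conv x r s.+1 j + bin_conv x r s j.+1.
Proof.
rewrite /bin_conv !(big_ord_recr j.+1) /= !subnn !addn0 !binn addrA.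
congr (_ + _); rewrite -big_split; apply: eq_bigr => i _ /=.
rewrite subSn; last by rewrite -ltnS ltn_ord.
by rewrite !addnS !addSn binS natrD mulrDr mulrDl.
Qed.

Lemma bin_conv0 x r s : bin_conv x r s 0 = 1.
Proof. by rewrite /bin_conv big_ord1 /= !addn0 !binn !mul1r. Qed.

Lemma bin_conv_rec1 x r :
  bin_conv x r.+1 r.+1 1 = (1 + x) * bin_conv x r.+1 r.+1 0 + bin_conv x r r 1.
Proof. by rewrite bin_convSl bin_convSr !bin_conv0; ring. Qed.

(** Multiplying the series by $(1 - t)(1 - xt) = 1 - (1 + x)t + xt^2$ lowers both exponents by
    one. *)
Lemma bin_conv_rec x r j :
  bin_conv x r.+1 r.+1 j.+2 =
  (1 + x) * bin_conv x r.+1 r.+1 j.+1 - x * bin_conv x r.+1 r.+1 j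
  + bin_conv x r r j.+2.
Proof.
rewrite bin_convSl [bin_conv x r r.+1 j.+2]bin_convSr.
have -> : bin_conv x r r.+1 j.+1 =
  bin_conv x r.+1 r.+1 j.+1 - x * bin_conv x r.+1 r.+1 j.
  by rewrite bin_convSl addrC addKr.
ring.
Qed.

Lemma bin_conv00 x j : bin_conv x 0 0 j = \sum_(i < j.+1) x ^+ i.
Proof. by apply: eq_bigr => i _; rewrite !bin0 !mul1r. Qed.

Lemma bin_conv00_rec x j :
  bin_conv x 0 0 j.+2 = (1 + x) * bin_conv x 0 0 j.+1 - x * bin_conv x 0 0 j.
Proof. by rewrite !bin_conv00 !big_ord_recr /= !exprS; ring. Qed.

(** * The coefficients $a_{k,m}$, with $x$ for $q$, and their recurrence *)

Definition hcoef x k m : R :=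
  if (m <= k <= m.*2)%N then bin_conv x (k - m) (k - m) (m.*2 - k) else 0.

Lemma hcoefE x r j k m : k = (m + r)%N -> m = (r + j)%N ->
  hcoef x k m = bin_conv x r r j.
Proof.
move=> -> ->; rewrite /hcoef ifT; last by lia.
by congr bin_conv; lia.
Qed.

Lemma hcoef_out x k m : ~~ (m <= k <= m.*2)%N -> hcoef x k m = 0.
Proof. by rewrite /hcoef => /negPf->. Qed.

Lemma hcoef_rec1 x k :
  hcoef x k.+2 1 = (1 + x) * hcoef x k.+1 0 + hcoef x k 0.
Proof.
rewrite (@hcoef_out x k.+1 0) // mulr0 add0r.
case: k => [|k]; last by rewrite !hcoef_out.
by rewrite (@hcoefE x 1 0) // (@hcoefE x 0 0) // !bin_conv0.
Qed.

(** The first three entries share the difference $k - m$ and the last has it lowered by one, so away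
    from the borders this is [bin_conv_rec]. *)
Lemma hcoef_rec x k m :
  hcoef x k.+2 m.+2 =
  (1 + x) * hcoef x k.+1 m.+1 - x * hcoef x k m + hcoef x k m.+1.
Proof.
case: (ltngtP m k) => [lt_mk | lt_km | <-].
- have [r ->] : exists r, k = (m.+1 + r)%N by exists (k - m.+1)%N; lia.
  (* The left-hand entry has degree $m + 1 - r$ in $t$: at least 2, at most 0, or exactly 1 in the
     three cases. *)
  case: (ltngtP r m) => [lt_rm | lt_mr | ->].
  + have [j ->] : exists j, m = (r + j.+1)%N by exists (m - r.+1)%N; lia.
    rewrite [hcoef x _.+2 _](@hcoefE x r.+1 j.+2); try lia.
    rewrite [hcoef x _.+1 _.+1](@hcoefE x r.+1 j.+1); try lia.
    rewrite [hcoef x _ _.+1](@hcoefE x r j.+2); try lia.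
    by rewrite [hcoef x _ _](@hcoefE x r.+1 j) ?bin_conv_rec //; lia.
  + rewrite [hcoef x _.+1 m.+1]hcoef_out ?[hcoef x _ m]hcoef_out; try lia.
    case: (ltngtP r m.+1) => [||->]; first by lia.
    * by move=> lt_mr1; rewrite !hcoef_out; [ring | lia ..].
    * rewrite (@hcoefE x m.+2 0) ?(@hcoefE x m.+1 0) ?bin_conv0; try lia.
      ring.
  + rewrite [hcoef x _ m]hcoef_out; try lia.
    rewrite [hcoef x _.+2 _](@hcoefE x m.+1 1); try lia.
    rewrite [hcoef x _.+1 _](@hcoefE x m.+1 0); try lia.
    rewrite [hcoef x _ _](@hcoefE x m 1); try lia.
    by rewrite bin_conv_rec1; ring.
- by rewrite !hcoef_out; [ring | lia ..].
- rewrite [hcoef x m m.+1]hcoef_out; try lia.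
  rewrite [hcoef x _ m.+2](@hcoefE x 0 m.+2); try lia.
  rewrite [hcoef x _ m.+1](@hcoefE x 0 m.+1); try lia.
  rewrite [hcoef x _ m](@hcoefE x 0 m); try lia.
  by rewrite bin_conv00_rec addr0.
Qed.

(* The two-variable case of [h_k] at roots [y], [y'] of
   [T^2 - (1 + x) z T + (x z^2 - z)]: both sides satisfy the recurrence with this
   characteristic polynomial. *)
Lemma complete_hom2_expansion x y y' z N k :
    y + y' = (1 + x) * z -> y * y' = x * z ^+ 2 - z -> (k < N)%N ->
  \sum_(i < k.+1) y ^+ (k - i) * y' ^+ i = \sum_(m < N) hcoef x k m * z ^+ m.
Proof.
move=> sum_y prod_y.
pose h k := \sum_(i < k.+1) y ^+ (k - i) * y' ^+ i.
have hS j : h j.+1 = y * h j + y' ^+ j.+1.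
  rewrite /h big_ord_recr /= subnn mul1r mulr_sumr; congr (_ + _).
  apply: eq_bigr => i _; rewrite subSn; last by rewrite -ltnS ltn_ord.
  by rewrite exprS mulrA.
have h_rec j : h j.+2 = (1 + x) * z * h j.+1 - (x * z ^+ 2 - z) * h j.
  rewrite -sum_y -prod_y [h j.+2]hS.
  have -> : y' ^+ j.+2 = y' * (h j.+1 - y * h j) by rewrite hS addrC addKr -exprS.
  ring.
rewrite -/(h k).
elim/ltn_ind: k N => -[|[|k]] IHk [|N] // ltkN.
- rewrite big_ord_recl big1 => [|i _]; last by rewrite hcoef_out ?mul0r.
  rewrite /h big_ord1 (@hcoefE x 0 0) // bin_conv0; ring.
- case: N ltkN => // N _; rewrite !big_ord_recl big1 => [|i _]; last first.
    by rewrite hcoef_out ?mul0r.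
  rewrite hcoef_out // (@hcoefE x 0 1) // bin_conv00 hS /h !big_ord_recl !big_ord0 /=.
  by rewrite subnn !expr0 !mulr1 !addr0 add0r !mulr1 sum_y.
case: N ltkN => // N ltkN.
have h1 : h k.+1 = hcoef x k.+1 0 + \sum_(i < N) hcoef x k.+1 i.+1 * z ^+ i.+1.
  by rewrite (IHk _ _ N.+1) // big_ord_recl mulr1.
(* Two expansions of [h k]: this one goes with the factor $z$, the next with $x z^2$, so that all
   sums run over $z^{i+2}$. *)
have h0 : h k = hcoef x k 0 + \sum_(i < N) hcoef x k i.+1 * z ^+ i.+1.
  by rewrite (IHk _ _ N.+1) ?big_ord_recl ?mulr1 //; lia.
have h0' : h k = \sum_(i < N) hcoef x k i * z ^+ i by apply: IHk.
have -> : h k.+2 = (1 + x) * z * h k.+1 + z * h k - x * z ^+ 2 * h k.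
  by rewrite h_rec; ring.
rewrite {1}h0 h0' h1 !big_ord_recl /= expr1 [hcoef x k.+2 0]hcoef_out // hcoef_rec1.
have -> : \sum_(i < N) hcoef x k.+2 (bump 0 (bump 0 i)) * z ^+ bump 0 (bump 0 i) =
    (1 + x) * z * (\sum_(i < N) hcoef x k.+1 i.+1 * z ^+ i.+1)
    - x * z ^+ 2 * (\sum_(i < N) hcoef x k i * z ^+ i)
    + z * (\sum_(i < N) hcoef x k i.+1 * z ^+ i.+1).
  rewrite !mulr_sumr -sumrB -big_split; apply: eq_bigr => i _.
  by rewrite /bump /= !add1n hcoef_rec !exprS; ring.
by rewrite [hcoef x k.+1 0]hcoef_out //; ring.
Qed.

End CompleteSymmetric.

(** * Inverting a Faulhaber expansion over a field *)

Section FaulhaberInversion.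
Variables (F : fieldType) (x : F).
Hypotheses (x_neq0 : x != 0) (expx_neq1 : forall n, 1 - x ^+ n.+1 != 0).

Definition gauss_int n : F := (1 - x ^+ n) / (1 - x).
(** [node n] and [oblong n] are $z_n$ and $y_n$, with $x$ for $q$. *)
Definition node n : F := gauss_int n ^+ 2 / x ^+ n.
Definition oblong n : F := gauss_int n * gauss_int n.+1 / x ^+ n.
Definition odd_power_sum m n : F :=
  \sum_(1 <= k < n.+1)
     gauss_int (2 * k) / gauss_int 2 * gauss_int k ^+ (2 * m) * x ^+ (m.+1 * (n - k)).

Let x_neq1 : 1 - x != 0. Proof. exact: expx_neq1 0. Qed.
Let expx_neq0 n : x ^+ n != 0. Proof. by rewrite expf_neq0. Qed.

Lemma gauss_int_neq0 n : gauss_int n.+1 != 0.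
Proof. by rewrite mulf_neq0 ?invr_neq0. Qed.

Lemma oblong_diff n :
  oblong n.+1 - oblong n = gauss_int (2 * n.+1) / x ^+ n.+1.
Proof.
rewrite /oblong /gauss_int mulnC exprM !exprS; field.
by rewrite expx_neq0 x_neq0 x_neq1.
Qed.

Lemma oblong_sum n : oblong n.+1 + oblong n = (1 + x) * node n.+1.
Proof.
rewrite /oblong /node /gauss_int !exprS; field.
by rewrite expx_neq0 x_neq0 x_neq1.
Qed.

Lemma oblong_prod n :
  oblong n.+1 * oblong n = x * node n.+1 ^+ 2 - node n.+1.
Proof.
rewrite /oblong /node /gauss_int !exprS; field.
by rewrite expx_neq0 x_neq0 x_neq1.
Qed.

Lemma node_eqE n d : node n = node (d.+1 + n) ->
  (1 - x ^+ n) ^+ 2 * x ^+ d.+1 = (1 - x ^+ (d.+1 + n)) ^+ 2.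
Proof.
have nodeE k : (1 - x ^+ k) ^+ 2 = node k * x ^+ k * (1 - x) ^+ 2.
  by rewrite /node /gauss_int; field; rewrite x_neq1 expx_neq0.
by move=> eq_node; rewrite !nodeE eq_node exprD; ring.
Qed.

Lemma odd_power_sumS m n :
  odd_power_sum m n.+1 =
  x ^+ m.+1 * odd_power_sum m n
  + gauss_int (2 * n.+1) / gauss_int 2 * gauss_int n.+1 ^+ (2 * m).
Proof.
rewrite /odd_power_sum big_nat_recr //= subnn muln0 mulr1 mulr_sumr; congr (_ + _).
apply: eq_big_nat => k /andP[_ lt_kn].
by rewrite subSn // mulnS exprD mulrCA.
Qed.

Variable c : nat -> nat -> F.
Hypothesis faulhaber : forall m n, (1 <= n)%N ->
  odd_power_sum m n =
  \sum_(0 <= k < m.+1)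
    c m k * x ^+ ((m - k) * n) * ((gauss_int n * gauss_int n.+1) ^+ k.+1 / gauss_int 2).

Lemma sum_faulhaber_oblong m n :
  \sum_(k < m.+1) c m k * oblong n ^+ k.+1 =
  gauss_int 2 * odd_power_sum m n / x ^+ (m.+1 * n).
Proof.
(* [faulhaber] starts at $n = 1$; at $n = 0$, needed for the first difference, both sides vanish. *)
case: n => [|n].
  rewrite /odd_power_sum big_geq // mulr0 mul0r big1 // => k _.
  by rewrite /oblong /gauss_int subrr !mul0r expr0n mulr0.
rewrite faulhaber // big_mkord mulr_sumr mulr_suml; apply: eq_bigr => k _.
have le_km : (k <= m)%N by rewrite -ltnS ltn_ord.
(* This splitting cancels the power of $x$ in the Faulhaber summand and leaves the denominator of
   [oblong n.+1 ^+ k.+1]. *)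
have -> : (m.+1 * n.+1 = (m - k) * n.+1 + n.+1 * k.+1)%N by nia.
rewrite /oblong expr_div_n -exprM [x ^+ (_ + _)]exprD.
move: (gauss_int_neq0 1) (expx_neq0 ((m - k) * n.+1)) (expx_neq0 (n.+1 * k.+1)).
move: (_ ^+ k.+1) (gauss_int 2) (x ^+ _) (x ^+ _) => u v w t v0 w0 t0.
by field; rewrite v0 w0 t0.
Qed.

(* Consecutive differences in [n] of the Faulhaber identity. *)
Lemma sum_faulhaber_complete_hom2 m n :
  \sum_(k < m.+1) c m k *
    \sum_(i < k.+1) oblong n.+1 ^+ (k - i) * oblong n ^+ i = node n.+1 ^+ m.
Proof.
have diff_neq0 : oblong n.+1 - oblong n != 0.
  by rewrite oblong_diff mulf_neq0 ?invr_neq0 // mulnS gauss_int_neq0.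
(* Multiplied by $y - y'$, the inner sum becomes $y^{k+1} - y'^{k+1}$. *)
apply: (mulfI diff_neq0); rewrite mulr_sumr.
rewrite (eq_bigr (fun k : 'I_m.+1 =>
    c m k * oblong n.+1 ^+ k.+1 - c m k * oblong n ^+ k.+1)); last first.
  by move=> k _; rewrite mulrCA -mulrBr subrXX.
rewrite sumrB !sum_faulhaber_oblong odd_power_sumS oblong_diff.
rewrite [node _ ^+ m]expr_div_n -!exprM mulf_div -exprD -mulnS [(n.+1 * _)%N]mulnC.
rewrite [(m.+1 * n.+1)%N]mulnS (exprD x m.+1).
move: (gauss_int_neq0 1) (expx_neq0 m.+1) (expx_neq0 (m.+1 * n)).
move: (gauss_int 2) (x ^+ m.+1) (x ^+ (m.+1 * n)) (odd_power_sum _ _) => u v w s u0 v0 w0.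
by field; rewrite u0 v0 w0.
Qed.

Lemma faulhaber_mul_hcoef n : injective node ->
  (\matrix_(k < n.+1, m < n.+1) if (m <= k)%N then c k m else 0)
    *m (\matrix_(k < n.+1, m < n.+1) hcoef x k m) = 1%:M.
Proof.
move=> node_inj; set B := (X in X *m _); set A := (X in _ *m X).
apply/matrixP=> i j.
(* Row $i$ of $BA$ read as a polynomial in $z$, minus $z^i$; its vanishing makes that row the $i$-th
   unit row. *)
pose p : {poly F} := \poly_(l < n.+1) (B *m A) i (inord l) - 'X^i.
have size_p : (size p <= n.+1)%N.
  by rewrite (leq_trans (size_polyD _ _)) // geq_max size_poly size_polyN size_polyXn ltn_ord.
have root_p k : root p (node k.+1).
  rewrite rootE hornerD hornerN hornerXn horner_poly subr_eq0.
  rewrite -sum_faulhaber_complete_hom2.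
  under eq_bigr => l _ do rewrite inord_val mxE mulr_suml.
  (* The sum over $l \le i$ is padded by the zeros of $B$ above the diagonal. *)
  rewrite exchange_big /= (big_ord_widen n.+1 (fun l => c i l *
    \sum_(t < l.+1) oblong k.+1 ^+ (l - t) * oblong k ^+ t)) //.
  apply/eqP; rewrite [RHS]big_mkcond /=; apply: eq_bigr => l _.
  under eq_bigr => t _ do rewrite !mxE -mulrA.
  rewrite -mulr_sumr ltnS; case: ifP => _; last by rewrite mul0r.
  by rewrite -(complete_hom2_expansion (oblong_sum k) (oblong_prod k)).
have p0 : p = 0.
  (* Degree at most $n$, yet $n + 1$ distinct roots $z_1, \dots, z_{n+1}$. *)
  apply/eqP; apply: contraT => p_neq0.
  have := max_poly_roots (rs := [seq node k.+1 | k <- iota 0 n.+1]) p_neq0.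
  rewrite size_map size_iota ltnNge size_p; apply.
    by apply/allP=> _ /mapP[k _ ->].
  by rewrite map_inj_uniq ?iota_uniq // => k l /node_inj[].
have := congr1 (fun r : {poly F} => r`_j) p0.
rewrite coefB coef_poly ltn_ord inord_val coefXn coef0 => /eqP; rewrite subr_eq0 => /eqP->.
by rewrite mxE eq_sym.
Qed.
End FaulhaberInversion.

(** * Specialisation to rational functions in $q$ *)

Lemma q_neq0 : q != 0.
Proof. by rewrite /q tofrac_eq0 polyX_eq0. Qed.

Lemma expq_neq1 n : 1 - q ^+ n.+1 != 0.
Proof.
rewrite /q -tofrac1 -tofracXn -tofracB tofrac_eq0.
apply/eqP => /(congr1 (horner^~ 0)).
by rewrite !hornerE expr0n subr0 => /eqP; rewrite oner_eq0.
Qed.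

(* After clearing denominators, setting [q = 0] separates the two sides. *)
Lemma node_addS_neq n d : node q n <> node q (d.+1 + n).
Proof.
move/(node_eqE q_neq0 expq_neq1).
rewrite /q -!tofracXn -tofrac1 -!tofracB -!tofracXn -tofracM => /eqP.
rewrite tofrac_eq => /eqP /(congr1 (horner^~ 0)).
rewrite !hornerE !expr0n /= mulr0 subr0 expr1n.
by move=> /eqP; rewrite eq_sym oner_eq0.
Qed.

Lemma node_q_inj : injective (node q).
Proof.
move=> n m; case: (ltngtP n m) => // [lt_nm | lt_mn] eq_nm.
- by case: (@node_addS_neq n (m - n.+1)); rewrite addSnnS subnK.
- by case: (@node_addS_neq m (n - m.+1)); rewrite addSnnS subnK.
Qed.

Lemma acoefE k m : acoef k m = hcoef q k m.
Proof.
rewrite /acoef /hcoef; case: leqP => //= le_mk; rewrite mul2n.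
case: leqP => [le_k2m | lt_2mk]; first by rewrite subzn //= complete_sym_two_blocks.
(* For $k > 2m$ the degree is negative, so [h1q] takes its zero branch. *)
by have [d ->] : exists d, (m.*2)%:Z - k%:Z = Negz d by exists (k - m.*2).-1; lia.
Qed.

Theorem theorem2 (P : nat -> nat -> {poly int}) (hP : q_Faulhaber P) :
  (forall k m : nat,
     acoef k m =
     if (m <= k)%N then
       \sum_(0 <= i < (2 * m).+1 - k)
          'C(k - m + i, k - m)%:R * 'C(m - i, k - m)%:R * q ^+ i
     else 0) /\
  (forall n : nat,
     let A : 'M[Kq]_n.+1 := \matrix_(k < n.+1, m < n.+1) acoef k m in
     let B : 'M[Kq]_n.+1 :=
       \matrix_(k < n.+1, m < n.+1)
         if (m <= k)%N then
           (-1) ^+ (k - m) * (qfact m / qfact k.+1) * tofrac (P k (k - m)%N)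
         else 0 in
     A \in unitmx /\ invmx A = B).
Proof.
split=> [k m | n A B].
  rewrite acoefE /hcoef; case: leqP => //= le_mk; rewrite big_mkord mul2n.
  case: leqP => [le_k2m | lt_2mk]; last first.
    by rewrite (eqP (_ : m.*2.+1 - k == 0)%N) ?subn_eq0 ?big_ord0.
  rewrite subSn //; apply: eq_bigr => i _; congr (_ * 'C(_, _)%:R * _).
  by have := ltn_ord i; lia.
have BA1 : B *m A = 1%:M.
  have -> : A = \matrix_(k < n.+1, m < n.+1) hcoef q k m.
    by apply/matrixP=> k m; rewrite !mxE acoefE.
  (* [hP] serves as [faulhaber] because [gauss_int q] and [odd_power_sum q] unfold to [qint] and
     [qsum_odd]. *)
  exact: faulhaber_mul_hcoef q_neq0 expq_neq1 _ hP _ node_q_inj.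
(* For square matrices a left inverse is two-sided. *)
have [_ A_unit] := mulmx1_unit BA1.
by split=> //; rewrite -[LHS]mul1mx -BA1 mulmxK.
Qed.
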